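(* Let $G$ be a finite simple graph each of whose connected components has at least one edge, with $m$ edges and minimum degree $\delta$. Then $$GA_1(G)\ge \frac{2\,\delta^{1/2}m^2}{M_1^{3/2}(G)},$$ and the equality is attained if and only if $G$ is regular.
   Context: For a finite simple graph $G$, with $d_u$ the degree of the vertex $u$, the first geometric-arithmetic index is $GA_1(G)=\sum_{uv\in E(G)}\frac{2\sqrt{d_u d_v}}{d_u+d_v}$ (each edge counted once). For $\alpha\in\mathbb{R}$, $M_1^{\alpha}(G)=\sum_{u\in V(G)}d_u^{\alpha}$ is the first variable Zagreb index; in particular $M_1^{3/2}(G)=\sum_{u\in V(G)}d_u^{3/2}$ (the superscript is an index parameter, not a power of $M_1(G)$). *)

(* Defs.v *)
From mathcomp Require Import all_boot all_order all_algebra.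
From mathcomp Require Import all_reals exp.
Set Implicit Arguments.
Unset Strict Implicit.
Unset Printing Implicit Defensive.
Import Order.TTheory GRing.Theory Num.Theory.
Local Open Scope ring_scope.

Record sgraph := SGraph {
  vertex :> finType;
  adj : rel vertex;
  adj_sym : symmetric adj;
  adj_irrefl : irreflexive adj
}.

Definition degree (G : sgraph) (u : G) : nat := #|[set v : G | adj u v]|.

(* An edge is the two-element set of its endpoints, so it is counted once. *)
Definition edges (G : sgraph) : {set {set G}} :=
  [set [set p.1; p.2] | p : G * G & adj p.1 p.2].

Definition components (G : sgraph) : {set {set G}} :=
  [set [set v : G | connect (@adj G) u v] | u : G].

(* Attainment makes this unsatisfiable for the graph without vertices, which
   has no minimum degree. *)
Definition is_min_degree (G : sgraph) (delta : nat) : Prop :=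
  (exists u : G, degree u = delta) /\ (forall u : G, (delta <= degree u)%N).

Definition regular (G : sgraph) : Prop :=
  exists k : nat, forall u : G, degree u = k.

(* For an edge f = {u, v}, u <> v, the product and the sum over the endpoints
   of f are d_u d_v and d_u + d_v. *)
Definition GA1 (R : realType) (G : sgraph) : R :=
  \sum_(f in edges G)
    2 * Num.sqrt (\prod_(u in f) (degree u)%:R) / (\sum_(u in f) (degree u)%:R).

(* For alpha != 0, powR gives isolated vertices the value 0; for positive
   degrees it is the usual real power. *)
Definition M1 (R : realType) (alpha : R) (G : sgraph) : R :=
  \sum_(u : G) (degree u)%:R `^ alpha.

(* Main.v *)
Require Import Defs.
From mathcomp Require Import all_boot all_order all_algebra.
From mathcomp Require Import all_reals exp.
From mathcomp Require Import ring.
Set Implicit Arguments.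
Unset Strict Implicit.
Unset Printing Implicit Defensive.
Import Order.TTheory GRing.Theory Num.Theory.
Local Open Scope ring_scope.

(** Write [s = sqrt delta] and, on an edge [uv], [a = (d_u + d_v) / (2 sqrt (d_u d_v))],
    so that [GA1] is the sum of the [1 / a]. Since [sqrt (d_u / d_v) <= sqrt d_u / s],
    [a <= (sqrt d_u + sqrt d_v) / (2 s)], and the right-hand sides sum over the
    edges to [A = M1 (3/2) / (2 s)] by double counting. Summing the tangent
    inequality [1 / a >= 2 t - t^2 a] at [t = m / A] gives [GA1 >= m^2 / A].
    Equality forces [d_u = d_v = delta] on every edge, and every vertex lies on
    an edge. *)

Lemma edgesP (G : sgraph) (f : {set G}) :
  reflect (exists u v : G, adj u v /\ f = [set u; v]) (f \in edges G).
Proof.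
apply: (iffP imsetP) => [[[u v]]|[u [v [uv ->]]]].
  by rewrite inE => uv ->; exists u, v.
by exists (u, v); rewrite ?inE.
Qed.

Lemma adj_neq (G : sgraph) (u v : G) : adj u v -> u != v.
Proof. by apply: contraTneq => ->; rewrite adj_irrefl. Qed.

(** The map sending a neighbour [v] to [[set u; v]] is onto the edges at [u], and injective because
    no neighbour equals [u]. *)
Lemma card_edges_at (G : sgraph) (u : G) :
  #|[set f in edges G | u \in f]| = degree u.
Proof.
have -> : [set f in edges G | u \in f]
        = [set [set u; v] | v in [set v : G | adj u v]].
  apply/setP => f; rewrite inE; apply/andP/imsetP.
    case=> /edgesP[x [y [xy ->]]]; rewrite !inE => /orP[]/eqP ->.
      by exists y; rewrite ?inE.
    by exists x; rewrite ?inE 1?adj_sym // setUC.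
  case=> v; rewrite inE => uv ->; split; last by rewrite !inE eqxx.
  by apply/edgesP; exists u, v.
apply: card_in_imset => v w; rewrite !inE => uv uw /setP/(_ v).
by rewrite !inE eqxx orbT eq_sym (negPf (adj_neq uv)) => /esym/eqP.
Qed.

Lemma sum_edges_endpoints (R : pzSemiRingType) (G : sgraph) (g : G -> R) :
  \sum_(f in edges G) \sum_(u in f) g u = \sum_(u : G) (degree u)%:R * g u.
Proof.
rewrite (exchange_big_dep predT) //=; apply: eq_bigr => u _.
rewrite -card_edges_at mulr_natl -sumr_const; apply: eq_bigl => f.
by rewrite inE.
Qed.

(** An edge inside the component of [u] has an endpoint [a] reachable from [u]. If the path to [a]
    is empty, the other endpoint is a neighbour of [u]; otherwise its first step is. *)
Lemma degree_gt0 (G : sgraph) :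
  (forall C : {set G}, C \in components G ->
     exists2 f : {set G}, f \in edges G & f \subset C) ->
  forall u : G, (0 < degree u)%N.
Proof.
move=> hcomp u.
have [|f /edgesP[a [b [ab ->]]] /subsetP/(_ a)] :=
  hcomp [set v : G | connect (@adj G) u v]; first exact: imset_f.
rewrite !inE eqxx => /(_ isT)/connectP[[|w p] /= pth ea]; apply/card_gt0P.
  by exists b; rewrite inE -ea.
by exists w; rewrite inE; case/andP: pth.
Qed.

(** Here [x] and [y] stand for the square roots of the end degrees. With
    [a = (x ^+ 2 + y ^+ 2) / (2 * (x * y))], the first term is the tangent error
    [(1 - t * a) ^+ 2 / a], and the second is [t ^+ 2] times the slack in
    [a <= (x + y) / (2 * s)]. *)
Lemma tangent_gap (R : realFieldType) (x y s t : R) : 0 < x -> 0 < y -> 0 < s ->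
  2 * (x * y) / (x ^+ 2 + y ^+ 2) - (2 * t - t ^+ 2 * ((x + y) / (2 * s)))
  = (2 * (x * y) - t * (x ^+ 2 + y ^+ 2)) ^+ 2
      / (2 * (x * y) * (x ^+ 2 + y ^+ 2))
    + t ^+ 2 * (x ^+ 2 * (y - s) + y ^+ 2 * (x - s)) / (2 * s * (x * y)).
Proof.
move=> x0 y0 s0.
have q0 : x ^+ 2 + y ^+ 2 != 0 by rewrite gt_eqF // addr_gt0 ?exprn_gt0.
by field; rewrite q0 !gt_eqF.
Qed.

Lemma tangent_gap_ge0 (R : realFieldType) (x y s t : R) :
  0 < s -> s <= x -> s <= y ->
  0 <= (2 * (x * y) - t * (x ^+ 2 + y ^+ 2)) ^+ 2
         / (2 * (x * y) * (x ^+ 2 + y ^+ 2))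
  /\ 0 <= t ^+ 2 * (x ^+ 2 * (y - s) + y ^+ 2 * (x - s)) / (2 * s * (x * y)).
Proof.
move=> s0 sx sy; have x0 := lt_le_trans s0 sx; have y0 := lt_le_trans s0 sy.
have xy0 : 0 <= x * y by rewrite mulr_ge0 ?ltW.
split; apply: divr_ge0; rewrite ?sqr_ge0 //.
- by apply: mulr_ge0; [exact: mulr_ge0 | rewrite addr_ge0 ?sqr_ge0].
- apply: mulr_ge0; first exact: sqr_ge0.
  by apply: addr_ge0; apply: mulr_ge0; rewrite ?sqr_ge0 ?subr_ge0.
- by apply: mulr_ge0 => //; rewrite mulr_ge0 ?ltW.
Qed.

Lemma tangent_le (R : realFieldType) (x y s t : R) :
  0 < s -> s <= x -> s <= y ->
  2 * t - t ^+ 2 * ((x + y) / (2 * s)) <= 2 * (x * y) / (x ^+ 2 + y ^+ 2).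
Proof.
move=> s0 sx sy; have [gap1 gap2] := tangent_gap_ge0 t s0 sx sy.
rewrite -subr_ge0 tangent_gap ?addr_ge0 //; exact: lt_le_trans s0 _.
Qed.

Lemma tangent_eq (R : realFieldType) (x y s t : R) :
  0 < s -> s <= x -> s <= y -> t != 0 ->
  2 * t - t ^+ 2 * ((x + y) / (2 * s)) = 2 * (x * y) / (x ^+ 2 + y ^+ 2) ->
  x = s /\ y = s.
Proof.
move=> s0 sx sy t0; have x0 := lt_le_trans s0 sx; have y0 := lt_le_trans s0 sy.
have [gap1 gap2] := tangent_gap_ge0 t s0 sx sy.
move/esym/eqP; rewrite -subr_eq0 tangent_gap // paddr_eq0 //.
have den0 : 2 * s * (x * y) != 0 by rewrite !mulf_neq0 ?gt_eqF.
(* The vanishing of the slack term alone forces [x = y = s]. *)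
case/andP=> _; rewrite mulf_eq0 invr_eq0 (negPf den0) orbF.
rewrite mulf_eq0 sqrf_eq0 (negPf t0) /=.
rewrite paddr_eq0; try by rewrite mulr_ge0 ?sqr_ge0 ?subr_ge0.
rewrite !mulf_eq0 !subr_eq0 (gt_eqF x0) (gt_eqF y0) /=.
by case/andP=> /eqP-> /eqP->.
Qed.

Lemma powR_half (R : realType) (x : R) : 0 <= x -> x `^ (1 / 2) = Num.sqrt x.
Proof. by move=> x0; rewrite div1r powR12_sqrt. Qed.

Lemma powR_three_halves (R : realType) (x : R) :
  0 < x -> x `^ (3 / 2) = x * Num.sqrt x.
Proof.
move=> x0; have -> : 3 / 2 = 1 + 1 / 2 :> R by field.
by rewrite powRD ?(gt_eqF x0) ?implybT // powRr1 ?powR_half // ltW.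
Qed.

Lemma natr_sqr_sqrt (R : rcfType) (n : nat) : n%:R = Num.sqrt n%:R ^+ 2 :> R.
Proof. by rewrite sqr_sqrtr. Qed.

Lemma GA1_edge (R : realType) (G : sgraph) (u v : G) (uv : adj u v) :
  2 * Num.sqrt (\prod_(w in [set u; v]) (degree w)%:R)
    / (\sum_(w in [set u; v]) (degree w)%:R)
  = 2 * (Num.sqrt (degree u)%:R * Num.sqrt (degree v)%:R)
    / (Num.sqrt (degree u)%:R ^+ 2 + Num.sqrt (degree v)%:R ^+ 2) :> R.
Proof.
rewrite !big_setU1 ?inE ?adj_neq // !big_set1 sqrtrM //.
by rewrite -!natr_sqr_sqrt.
Qed.

Lemma M1_three_halves (R : realType) (G : sgraph) :
  (forall u : G, (0 < degree u)%N) ->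
  M1 (3 / 2) G
  = \sum_(f in edges G) \sum_(u in f) Num.sqrt (degree u)%:R :> R.
Proof.
move=> d0; rewrite sum_edges_endpoints; apply: eq_bigr => u _.
by rewrite powR_three_halves // ltr0n.
Qed.

Theorem theorem3p17 (R : realType) (G : sgraph) (m delta : nat)
    (hcomp : forall C : {set G}, C \in components G ->
       exists2 f : {set G}, f \in edges G & f \subset C)
    (hm : #|edges G| = m)
    (hdelta : is_min_degree G delta) :
  GA1 R G >= 2 * delta%:R `^ (1 / 2) * m%:R ^+ 2 / M1 (3 / 2) G
  /\ (GA1 R G = 2 * delta%:R `^ (1 / 2) * m%:R ^+ 2 / M1 (3 / 2) G
      <-> regular G).
Proof.
have d0 := degree_gt0 hcomp; case: hdelta => [[u0 du0] dmin].
rewrite powR_half //; set s := Num.sqrt _.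
have s0 : 0 < s by rewrite sqrtr_gt0 ltr0n -du0.
have sd (u : G) : s <= Num.sqrt (degree u)%:R by rewrite ler_wsqrtr // ler_nat.
have m0 : 0 < m%:R :> R.
  rewrite ltr0n -hm; apply: leq_trans (d0 u0) _.
  rewrite -card_edges_at; apply/subset_leq_card/subsetP => f.
  by rewrite inE => /andP[].
set M := M1 _ _.
have EM : M = \sum_(f in edges G) \sum_(u in f) Num.sqrt (degree u)%:R.
  exact: M1_three_halves.
have M0 : 0 < M.
  rewrite /M /M1 (bigD1 u0) //= ltr_wpDr ?powR_gt0 ?ltr0n //.
  by apply: sumr_ge0 => u _; exact: powR_ge0.
(* With [A = M / (2 * s)], this [t = m / A] maximises [2 * t * m - t ^+ 2 * A], the sum of the
   tangent bounds; the maximum is [m ^+ 2 / A]. *)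
set t := 2 * s * m%:R / M.
have t0 : 0 < t by rewrite divr_gt0 ?mulr_gt0.
pose b (f : {set G}) : R :=
  2 * t - t ^+ 2 * ((\sum_(u in f) Num.sqrt (degree u)%:R) / (2 * s)).
have b_edge (u v : G) : adj u v -> b [set u; v]
    = 2 * t - t ^+ 2 * ((Num.sqrt (degree u)%:R + Num.sqrt (degree v)%:R) / (2 * s)).
  by move=> uv; rewrite /b big_setU1 ?inE ?adj_neq // big_set1.
have <- : \sum_(f in edges G) b f = 2 * s * m%:R ^+ 2 / M.
  rewrite big_split /= sumr_const hm sumrN -mulr_sumr -mulr_suml -EM /t.
  by rewrite -mulr_natr; field; rewrite !gt_eqF.
have b_le f : f \in edges G -> b f <=
    2 * Num.sqrt (\prod_(u in f) (degree u)%:R) / (\sum_(u in f) (degree u)%:R).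
  by case/edgesP=> u [v [uv ->]]; rewrite GA1_edge // b_edge // tangent_le.
split; first exact: ler_sum.
split=> [eqG | [k dk]].
  exists delta => u.
  have /card_gt0P[v] := d0 u; rewrite inE => uv.
  have fE : [set u; v] \in edges G by apply/edgesP; exists u, v.
  (* Equal sums of termwise ordered families are equal term by term. *)
  have [_] := leif_sum (fun f fE => leif_eq (b_le f fE)).
  rewrite [X in _ == X]eqG eqxx => /esym/forall_inP/(_ _ fE)/eqP.
  rewrite GA1_edge // b_edge // => /tangent_eq[] //; first by rewrite gt_eqF.
  by move=> /eqP; rewrite eqr_sqrt ?ler0n // eqr_nat => /eqP.
have ds (u : G) : Num.sqrt (degree u)%:R = s by rewrite /s -du0 !dk.
(* In a regular graph every edge adds [2 * s] to [M], so [A = m]; both the bound and the [GA1] term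
   of each edge are then 1. *)
have t1 : t = 1.
  have -> : t = 2 * s * m%:R / (2 * s * m%:R).
    rewrite /t EM; congr (_ / _); rewrite -hm -sum1_card natr_sum mulr_sumr.
    apply: eq_bigr => f /edgesP[u [v [uv ->]]].
    by rewrite big_setU1 ?inE ?adj_neq // big_set1 !ds /=; ring.
  by rewrite divff // !mulf_neq0 ?gt_eqF.
apply: eq_bigr => f /edgesP[u [v [uv ->]]].
by rewrite GA1_edge // b_edge // !ds t1; field; rewrite (gt_eqF s0) gt_eqF // addr_gt0 ?exprn_gt0.
Qed.
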